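(* Let $k$ be a field, let $n\ge 1$, and let $G=(g_1,\ldots,g_t)^{\top}\in k[x_1,\ldots,x_n]^t$ be a Gröbner basis (with respect to some term order) of a proper $0$-dimensional ideal in $k[x_1,\ldots,x_n]$. Let $A\in k[x_1,\ldots,x_n]^{s\times t}$ and let $F=(f_1,\ldots,f_s)^{\top}=AG$. Then: 1. If $\langle F\rangle=\langle G\rangle$, then $s\ge n$. 2. If $A$ has a left-inverse in $k[x_1,\ldots,x_n]^{t\times s}$, then $\langle F\rangle=\langle G\rangle$. 3. The equality $\langle F\rangle=\langle G\rangle$ holds if and only if there exists a matrix $B\in k[x_1,\ldots,x_n]^{t\times s}$ such that each row of $BA-E_t$ is a syzygy of $G$, where $E_t$ is the identity matrix of size $t$.
   Context: For a vector (or finite set) $F=(f_1,\ldots,f_s)$ of polynomials, $\langle F\rangle$ denotes the ideal of $k[x_1,\ldots,x_n]$ generated by its entries. Saying that a vector is a Gröbner basis means that the set of its entries is one. For a term order $\prec$, $\mathrm{LT}(f)$ is the largest term (monomial) of $f$; a finite subset $G$ of an ideal $I$ is a $\prec$-Gröbner basis of $I$ if $\langle \mathrm{LT}(G)\rangle=\langle \mathrm{LT}(I)\rangle$. An ideal $I$ is $0$-dimensional if the $k$-vector space $k[x_1,\ldots,x_n]/I$ is finite-dimensional. A syzygy of $G=(g_1,\ldots,g_t)$ is a tuple $(q_1,\ldots,q_t)\in k[x_1,\ldots,x_n]^t$ with $q_1g_1+\cdots+q_tg_t=0$. *)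

(* Defs.v *)
From HB Require Import structures.
From mathcomp Require Export all_boot all_order all_algebra.
From mathcomp.multinomials Require Export mpoly.

Set Implicit Arguments.
Unset Strict Implicit.
Unset Printing Implicit Defensive.

Import GRing.Theory.

Local Open Scope ring_scope.

Section Ideals.
Variables (k : fieldType) (n : nat).

(* Ideals are Prop-valued predicates rather than the boolean [idealr], which
   would require membership to be decidable and the ideal to be proper. *)
Definition is_ideal (I : {mpoly k[n]} -> Prop) : Prop :=
  [/\ I 0,
      forall p q, I p -> I q -> I (p + q)
    & forall a p, I p -> I (a * p)].

Definition is_proper_ideal (I : {mpoly k[n]} -> Prop) : Prop :=
  is_ideal I /\ exists p, ~ I p.

Definition same_set (P Q : {mpoly k[n]} -> Prop) : Prop :=
  forall p, P p <-> Q p.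

Definition ideal_span (S : {mpoly k[n]} -> Prop) (p : {mpoly k[n]}) : Prop :=
  exists (r : nat) (a g : 'I_r -> {mpoly k[n]}),
    (forall i, S (g i)) /\ p = \sum_(i < r) a i * g i.

Definition entries (m : nat) (F : 'cV[{mpoly k[n]}]_m) (p : {mpoly k[n]}) :
    Prop :=
  exists i, p = F i 0.

Definition ideal_of (m : nat) (F : 'cV[{mpoly k[n]}]_m) :
    {mpoly k[n]} -> Prop :=
  ideal_span (entries F).

(* The quotient k[x_1,...,x_n]/I is spanned over k by the classes of finitely
   many polynomials b_0,...,b_(d-1). *)
Definition zero_dimensional (I : {mpoly k[n]} -> Prop) : Prop :=
  exists (d : nat) (b : 'I_d -> {mpoly k[n]}),
    forall p, exists c : 'I_d -> k, I (p - \sum_(i < d) c i *: b i).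

(* The library's order on 'X_{1..n} (and hence [mlead]) is a fixed degree
   order, so an arbitrary term order is passed as a relation.
   0%MM is the exponent of the monomial 1 and +%MM is multiplication. *)
Definition term_order (le : rel 'X_{1..n}) : Prop :=
  [/\ reflexive le, antisymmetric le, transitive le & total le]
  /\ (forall m, le 0%MM m)
  /\ (forall m1 m2 m, le m1 m2 -> le (m1 + m)%MM (m2 + m)%MM).

(* No monomial satisfies this when f = 0, so zero has no leading term. *)
Definition is_LT (le : rel 'X_{1..n}) (f : {mpoly k[n]}) (m : 'X_{1..n}) :
    Prop :=
  m \in msupp f /\ forall m', m' \in msupp f -> le m' m.

Definition LT_set (le : rel 'X_{1..n}) (S : {mpoly k[n]} -> Prop)
    (p : {mpoly k[n]}) : Prop :=
  exists (f : {mpoly k[n]}) (m : 'X_{1..n}),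
    [/\ S f, is_LT le f m & p = 'X_[m]].

Definition groebner_basis (le : rel 'X_{1..n}) (I : {mpoly k[n]} -> Prop)
    (t : nat) (G : 'cV[{mpoly k[n]}]_t) : Prop :=
  (forall g, entries G g -> I g)
  /\ same_set (ideal_span (LT_set le (entries G))) (ideal_span (LT_set le I)).

Definition syzygy (t : nat) (G : 'cV[{mpoly k[n]}]_t)
    (q : 'rV[{mpoly k[n]}]_t) : Prop :=
  \sum_(j < t) q 0 j * G j 0 = 0.

End Ideals.

(* Main.v *)
(** Over the quotient ring S = k[x]/I the f_i have the tautological common zero
    a, the tuple of the classes of the x_i.  Expanding at a, x_i |-> a_i + y_i,
    turns the f_i into polynomials h_i over S without constant term such that
    S[y]/(h) is still spanned over S by finitely many classes, say D of them.
    Iterating p = sum_j c_j e_j + sum_i h_i q_i, every polynomial is, modulo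
    (y)^N, an S-combination of the D * N^s products h^g e_j with all g_i < N.
    Comparing with the M^n monomials y^m, m_i < M, for N = n M + 1 gives
    M^n <= D N^s for every M, hence n <= s.  This needs neither a field S nor
    the Nullstellensatz: over any nonzero commutative ring,
    A B = 1 forces B to have at least as many rows as columns. *)
Require Import Defs.
From HB Require Import structures.
From Stdlib Require Import ClassicalEpsilon.
From mathcomp Require Import all_boot all_order all_algebra ring_quotient.
From mathcomp.multinomials Require Import mpoly.
From mathcomp Require Import zify.
Set Implicit Arguments.
Unset Strict Implicit.
Unset Printing Implicit Defensive.
Import GRing.Theory.
Local Open Scope ring_scope.

(** * Dickson's lemma and well-foundedness of term orders *)

Lemma monotone_subsequence (u : nat -> nat) :
  exists sg : nat -> nat, {homo sg : i j / (i < j)%N} /\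
    {homo (u \o sg) : i j / (i <= j)%N}.
Proof.
(* Every tail of [u] attains a minimum, by descent on a bound [v] for its values. Repeatedly
   choosing a minimizing index of the remaining tail yields [sg]. *)
have min_tail N :
    exists m, (N <= m)%N /\ forall j, (N <= j)%N -> (u m <= u j)%N.
  suff H v : forall m, (N <= m)%N -> (u m <= v)%N ->
      exists m, (N <= m)%N /\ forall j, (N <= j)%N -> (u m <= u j)%N.
    exact: (H (u N) N).
  elim: v => [|v IHv] m leNm lemv.
    by exists m; split=> // j _; apply: leq_trans lemv _.
  have [[j [leNj ltj]]|nlt] := classic (exists j, (N <= j)%N /\ (u j < u m)%N).
    by apply: (IHv j leNj); rewrite -ltnS; apply: leq_trans ltj lemv.
  exists m; split=> // j leNj; rewrite leqNgt; apply/negP => ltj.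
  by apply: nlt; exists j.
pose next N := proj1_sig (constructive_indefinite_description _ (min_tail N)).
have nextP N : (N <= next N)%N /\ forall j, (N <= j)%N -> (u (next N) <= u j)%N.
  by rewrite /next; case: constructive_indefinite_description.
pose sg := fix sg k := if k is k'.+1 then next (sg k').+1 else next 0%N.
have sg_lt i : (sg i < sg i.+1)%N by have [] := nextP (sg i).+1.
have sg_homo : {homo sg : i j / (i < j)%N}.
  by apply: homo_ltn => // ? ? ?; apply: ltn_trans.
exists sg; split=> //; apply: homo_leq => // [? ? ?|[|i]] /=.
- exact: leq_trans.
- by have [_ ->] := nextP 0%N.
by have [_ ->] := nextP (sg i).+1; rewrite //;
   have := ltn_trans (sg_lt i) (sg_lt i.+1); apply: leq_trans.
Qed.

(** Successive extraction makes the first [r] coordinates non-decreasing along a subsequence; at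
    [r = n] its first two terms are comparable. *)
Lemma dickson n (nu : nat -> 'X_{1..n}) :
  exists i j, (i < j)%N /\ (nu i <= nu j)%MM.
Proof.
suff sub r : exists sg : nat -> nat, {homo sg : i j / (i < j)%N} /\
    forall i j, (i <= j)%N ->
      forall l : 'I_n, (l < r)%N -> (nu (sg i) l <= nu (sg j) l)%N.
  have [sg [sg_lt sg_le]] := sub n; exists (sg 0%N), (sg 1%N).
  split; first exact: sg_lt.
  by apply/mnm_lepP => l; apply: sg_le.
elim: r => [|r [sg [sg_lt sg_le]]]; first by exists id; split.
have [ltrn|lenr] := ltnP r n; last first.
  exists sg; split=> // i j leij l _; apply: sg_le => //.
  exact: leq_trans (ltn_ord l) lenr.
have [tau [tau_lt tau_le]] :=
  monotone_subsequence (fun i => nu (sg i) (Ordinal ltrn)).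
exists (sg \o tau); split=> [i j ltij|i j leij l] /=; first exact/sg_lt/tau_lt.
rewrite ltnS leq_eqVlt => /predU1P[eqlr|ltlr].
  have -> : l = Ordinal ltrn by apply: val_inj.
  exact: tau_le.
apply: sg_le => //; move: leij; rewrite leq_eqVlt => /predU1P[->//|ltij].
by apply/ltnW/tau_lt.
Qed.

(** In an infinite strict descent, Dickson's lemma finds a monomial dividing a later one;
    divisibility implies [le], against the descent. *)
Lemma term_order_wf n (le : rel 'X_{1..n}) : term_order le ->
  well_founded (fun m m' => (m != m') && le m m').
Proof.
move=> [[le_refl le_anti le_trans le_total] [le0 leD]].
set lt := fun m m' => _.
(* The hypothesis sits under the existential so that choice gives a total function [next]. *)
have desc m : exists m', ~ Acc lt m -> lt m' m /\ ~ Acc lt m'.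
  have [|nall] := classic (exists m', lt m' m /\ ~ Acc lt m').
    by case=> m' ?; exists m'.
  exists m; case; constructor => m' lt_m'm; apply: NNPP => nacc.
  by apply: nall; exists m'.
pose next m := proj1_sig (constructive_indefinite_description _ (desc m)).
have nextP m : ~ Acc lt m -> lt (next m) m /\ ~ Acc lt (next m).
  by rewrite /next; case: constructive_indefinite_description.
move=> m; apply: NNPP => nacc_m; pose nu i := iter i next m.
have nacc i : ~ Acc lt (nu i) by elim: i => //= i /nextP[].
have nu_lt i : lt (nu i.+1) (nu i) by have /nextP[] := nacc i.
have nu_le i j : (i <= j)%N -> le (nu j) (nu i).
  move/subnK <-; elim: (j - i)%N => // d IHd; apply: le_trans IHd.
  by have /andP[] := nu_lt (d + i)%N.
have [i [j [ltij lepij]]] := dickson nu.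
have le_ij : le (nu i) (nu j).
  by have := leD _ _ (nu i) (le0 (nu j - nu i)%MM); rewrite add0m submK.
have /andP[/eqP] := nu_lt i; case; apply/le_anti/andP.
split; first exact: nu_le.
by apply: (le_trans _ _ _ le_ij); apply: nu_le.
Qed.

(** * The counting bound over a nonzero commutative ring *)

Lemma card_mulmx1_min (S : comNzRingType) (P Q : finType) (A : P -> Q -> S)
    (B : Q -> P -> S) :
  (forall p p', \sum_q A p q * B q p' = (p == p')%:R) -> (#|P| <= #|Q|)%N.
Proof.
move=> AB; apply: (@mulmx1_min S _ _
  (\matrix_(i, j) A (enum_val i) (enum_val j))
  (\matrix_(i, j) B (enum_val i) (enum_val j))).
apply/matrixP => i j; rewrite !mxE -(inj_eq enum_val_inj) -AB.
rewrite [RHS](reindex_onto enum_val enum_rank) => [|q _]; last first.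
  exact: enum_rankK.
apply: eq_big => [l|l _]; first by rewrite enum_valK eqxx.
by rewrite !mxE.
Qed.

Section Order.
Variables (S : comNzRingType) (n : nat).
Implicit Types (p q h : {mpoly S[n]}).

(* [low_free N p] states that p lies in the ideal (x_1, ..., x_n)^N. *)
Definition low_free (N : nat) p := forall m, (mdeg m < N)%N -> p@_m = 0.

(** If m = m1 + m2 has degree at most N, then either m1 = 0, where [h] vanishes, or m2 has degree
    below N, where [p] does. *)
Lemma low_freeM N h p : h@_0%MM = 0 -> low_free N p -> low_free N.+1 (h * p).
Proof.
move=> h0 pN m ltm; rewrite mcoeffM big1 // => -[m1 m2] /= /eqP mE.
have [->|m1_neq0] := eqVneq (m1 : 'X_{1..n}) 0%MM; first by rewrite h0 mul0r.
rewrite pN ?mulr0 //; move: m1_neq0 ltm (congr1 mdeg mE).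
by rewrite -mdeg_eq0 mdegD; lia.
Qed.

Lemma low_free_sum N (J : finType) (F : J -> {mpoly S[n]}) :
  (forall i, low_free N (F i)) -> low_free N (\sum_i F i).
Proof. by move=> HF m ltm; rewrite raddf_sum big1 // => i _; apply: HF. Qed.

Section Span.
Variables (s D : nat) (h : 'I_s -> {mpoly S[n]}) (e : 'I_D -> {mpoly S[n]}).

(** Bounded exponents make the index a finite type with N^s D elements, the inner dimension of the
    later matrix product. *)
Definition box_gen (N : nat) (u : {ffun 'I_s -> 'I_N} * 'I_D) : {mpoly S[n]} :=
  \prod_i h i ^+ u.1 i * e u.2.

Definition box_span (N : nat) q : Prop :=
  exists c : {ffun 'I_s -> 'I_N} * 'I_D -> S, q = \sum_u c u *: box_gen u.

Lemma box_spanD N p q : box_span N p -> box_span N q -> box_span N (p + q).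
Proof.
move=> [c ->] [d ->]; exists (fun u => c u + d u); rewrite -big_split.
by apply: eq_bigr => u _; rewrite scalerDl.
Qed.

Lemma box_spanZ N a p : box_span N p -> box_span N (a *: p).
Proof.
move=> [c ->]; exists (fun u => a * c u); rewrite scaler_sumr.
by apply: eq_bigr => u _; rewrite scalerA.
Qed.

Lemma box_span0 N : box_span N 0.
Proof. by exists (fun => 0); rewrite big1 // => u _; rewrite scale0r. Qed.

Lemma box_span_sum N (J : finType) (F : J -> {mpoly S[n]}) :
  (forall i, box_span N (F i)) -> box_span N (\sum_i F i).
Proof.
move=> HF; apply: big_ind => //; [exact: box_span0|exact: box_spanD].
Qed.

Lemma box_span_gen N (g : 'I_s -> nat) j : (forall i, g i < N)%N ->
  box_span N (\prod_i h i ^+ g i * e j).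
Proof.
move=> ltgN; pose u := ([ffun i => Ordinal (ltgN i)] , j).
exists (fun v => (v == u)%:R); rewrite (bigD1 u) //= eqxx scale1r.
rewrite [X in _ + X]big1 ?addr0 => [|v /negPf->]; last by rewrite scale0r.
by congr (_ * _); apply: eq_bigr => i _; rewrite ffunE.
Qed.

Lemma box_spanM N i q : box_span N q -> box_span N.+1 (h i * q).
Proof.
move=> [c ->]; rewrite mulr_sumr; apply: box_span_sum => -[g j].
rewrite -scalerAr; apply: box_spanZ; rewrite /box_gen /= mulrA.
have -> : h i * \prod_l h l ^+ g l = \prod_l h l ^+ (g l + (l == i)).
  under [RHS]eq_bigr => l _ do rewrite exprD.
  rewrite big_split /= mulrC; congr (_ * _).
  by rewrite (bigD1 i) //= eqxx big1 ?mulr1 // => l /negPf->.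
by apply: box_span_gen => l; case: (_ == _); have := ltn_ord (g l); lia.
Qed.

Hypothesis h0 : forall i, (h i)@_0%MM = 0.
Hypothesis he : forall p, exists (c : 'I_D -> S) (q : 'I_s -> {mpoly S[n]}),
  p = \sum_j c j *: e j + \sum_i h i * q i.

(** Each quotient [q i] from [he] is approximated to order N; multiplying by [h i] raises the order
    of the error by one and enlarges the box by one. *)
Lemma box_span_low_free N p : exists2 q, box_span N q & low_free N (p - q).
Proof.
elim: N p => [|N IHN] p; first by exists 0; [exact: box_span0|].
have [c [q ->]] := he p.
have [r rN qrN] := fin_all_exists2 (fun i => IHN (q i)).
exists (\sum_j c j *: e j + \sum_i h i * r i).
  apply: box_spanD; apply: box_span_sum => j; last exact: box_spanM.
  apply: box_spanZ; rewrite -[e j]mul1r.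
  have -> : 1 = \prod_i h i ^+ 0 by rewrite big1 // => i _; rewrite expr0.
  exact: box_span_gen.
rewrite opprD addrACA subrr add0r -sumrB; apply: low_free_sum => i.
by rewrite -mulrBr; apply: low_freeM.
Qed.

(** The monomials [mon a] have degree at most n M < N, so their approximations have the same
    coefficients at every [mon b]. This factors the identity matrix of size M^n through the box
    generators. *)
Lemma box_count M : (M ^ n <= (n * M).+1 ^ s * D)%N.
Proof.
pose N := (n * M).+1.
pose mon (a : {ffun 'I_n -> 'I_M}) := [multinom val (a i) | i < n].
have mon_lt a : (mdeg (mon a) < N)%N.
  have -> : N = (\sum_(i < n) M).+1 by rewrite sum_nat_const card_ord.
  rewrite mdegE ltnS.
  by apply: leq_sum => i _; rewrite mnmE; apply/ltnW/ltn_ord.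
have mon_inj : injective mon.
  move=> a b eqab; apply/ffunP => i; apply: val_inj.
  by move/mnmP/(_ i): eqab; rewrite !mnmE.
have /fin_all_exists[A HA] (a : {ffun 'I_n -> 'I_M}) :
    exists c : {ffun 'I_s -> 'I_N} * 'I_D -> S,
      low_free N ('X_[mon a] - \sum_u c u *: box_gen u).
  by have [q [c ->] Hc] := box_span_low_free N 'X_[mon a]; exists c.
have := @card_mulmx1_min S _ _ A (fun u b => (box_gen u)@_(mon b)).
rewrite card_prod !card_ffun !card_ord; apply=> a b.
have /eqP := HA a (mon b) (mon_lt b).
rewrite mcoeffB subr_eq0 mcoeffX raddf_sum (inj_eq mon_inj) => /eqP->.
by apply: eq_bigr => u _; rewrite /= mcoeffZ.
Qed.

Lemma nvars_le_of_span_mod : (n <= s)%N.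
Proof.
rewrite leqNgt; apply/negP => ltsn.
(* As M > (n+1)^s D and n M + 1 <= (n+1) M, the right side of [box_count] is below M^(s+1) <=
   M^n. *)
pose M := (n.+1 ^ s * D).+1; have := box_count M; apply/negP; rewrite -ltnNge.
apply: (@leq_ltn_trans ((n.+1 * M) ^ s * D)).
  rewrite leq_mul2r orbC; have [s0|s_gt0] := posnP s.
    by rewrite s0 !expn0.
  by rewrite leq_exp2r // mulSn -add1n leq_add2r.
apply: (@leq_trans (M ^ s.+1)); last by rewrite leq_pexp2l.
by rewrite expnMn mulnAC expnSr mulnC ltn_pmul2l ?expn_gt0.
Qed.

End Span.
End Order.

(** * Quotient rings and generators of zero-dimensional ideals *)

Lemma proper_ideal_quotient (k : fieldType) n (I : {mpoly k[n]} -> Prop) :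
  is_proper_ideal I ->
  exists (S : comNzRingType) (pi : {rmorphism {mpoly k[n]} -> S}),
    forall p, I p -> pi p = 0.
Proof.
move=> [[I0 ID IM] [p0 nIp0]].
pose P : {pred {mpoly k[n]}} := fun p =>
  if excluded_middle_informative (I p) then true else false.
have PE p : reflect (I p) (p \in P).
  by rewrite unfold_in /P; case: excluded_middle_informative => Ip; constructor.
have P_ideal : idealr_closed P.
  split=> [|/=|a p q /PE Ip /PE Iq]; first exact/PE.
    (* Properness excludes 1 from the ideal, so the quotient is a nonzero ring. *)
    by apply/PE => I1; apply: nIp0; rewrite -[p0]mulr1; apply: IM.
  by apply/PE/ID => //; apply: IM.
pose J : idealr {mpoly k[n]} := HB.pack P (isIdealr.Build _ P P_ideal).
exists {ideal_quot J}, (\pi_({ideal_quot J})%qT)%R => p Ip.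
have /eqP /= : (p == 0 %[mod {ideal_quot J}])%qT.
  by rewrite -Quotient.idealrBE subr0; apply/PE.
by move=> ->; apply: rmorph0.
Qed.

Section Generators.
Variables (k : fieldType) (n : nat).
Implicit Types (I : {mpoly k[n]} -> Prop).

(** Coefficients attached to the same entry index are summed, leaving one per index. *)
Lemma ideal_ofP m (F : 'cV[{mpoly k[n]}]_m) p :
  ideal_of F p <-> exists v : 'I_m -> {mpoly k[n]}, p = \sum_i v i * F i 0.
Proof.
split=> [[r [a [g [/fin_all_exists[f gE] ->]]]]|[v ->]]; last first.
  by exists m, v, (fun i => F i 0); split=> // i; exists i.
exists (fun i => \sum_(l | f l == i) a l).
rewrite (partition_big f predT) //=; apply: eq_bigr => i _.
by rewrite mulr_suml; apply: eq_bigr => l /eqP <-; rewrite gE.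
Qed.

Lemma ideal_of_ideal m (F : 'cV[{mpoly k[n]}]_m) : is_ideal (ideal_of F).
Proof.
split=> [|p q|a p].
- by apply/ideal_ofP; exists (fun => 0); rewrite big1 // => i _; rewrite mul0r.
- move=> /ideal_ofP[u ->] /ideal_ofP[v ->]; apply/ideal_ofP.
  exists (fun i => u i + v i); rewrite -big_split.
  by apply: eq_bigr => i _; rewrite mulrDl.
move=> /ideal_ofP[u ->]; apply/ideal_ofP; exists (fun i => a * u i).
by rewrite mulr_sumr; apply: eq_bigr => i _; rewrite mulrA.
Qed.

Lemma entry_ideal_of m (F : 'cV[{mpoly k[n]}]_m) i : ideal_of F (F i 0).
Proof.
exists 1%N, (fun=> 1), (fun=> F i 0).
by split; [exists i | rewrite big_ord1 mul1r].
Qed.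

Lemma ideal_of_mulmx l m (A : 'M_(l, m)) (F : 'cV[{mpoly k[n]}]_m) p :
  ideal_of (A *m F) p -> ideal_of F p.
Proof.
have [J0 JD JM] := ideal_of_ideal F.
move=> /ideal_ofP[v ->]; apply: big_ind => // i _; apply: (JM).
by rewrite mxE; apply: big_ind => // j _; apply: JM; apply: entry_ideal_of.
Qed.

Lemma zero_dimensional_generators m (F : 'cV[{mpoly k[n]}]_m) :
  is_proper_ideal (ideal_of F) -> zero_dimensional (ideal_of F) -> (n <= m)%N.
Proof.
move=> F_proper [D [b F_zd]].
have [S [pi pi0]] := proper_ideal_quotient F_proper.
pose iota : {rmorphism k -> {mpoly S[n]}} := @mpolyC n S \o pi \o @mpolyC n k.
have [phi phiX phiZ] : exists2 phi : {rmorphism {mpoly k[n]} -> {mpoly S[n]}},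
    forall i, phi 'X_i = (pi 'X_i)%:MP + 'X_i
    & forall c p, phi (c *: p) = pi c%:MP *: phi p.
  exists (mmap iota (fun i => (pi 'X_i)%:MP + 'X_i)) => [i|c p] /=.
    by rewrite mmapX mmap1U.
  by rewrite mmapZ mul_mpolyC.
(* Setting y = 0 in the expansion at a + y evaluates [p] at a; hence the images of the entries of
   [F] have no constant term. *)
have phi_coef0 p : (phi p)@_0%MM = pi p.
  rewrite (mpolyE p) !rmorph_sum; apply: eq_bigr => m' _.
  rewrite phiZ /= mcoeffZ -mul_mpolyC rmorphM; congr (_ * _).
  rewrite mpolyXE_id !rmorph_prod; apply: eq_bigr => i _.
  rewrite !rmorphXn /=; congr (_ ^+ _); rewrite phiX.
  by rewrite mcoeffD mcoeffC eqxx mulr1 mcoeffX mnm1_eq0 addr0.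
apply: (@nvars_le_of_span_mod S n m D
  (fun i => phi (F i 0)) (fun j => phi (b j))).
  by move=> i; rewrite phi_coef0 pi0 //; apply: entry_ideal_of.
set h := fun i => phi (F i 0); set e := fun j => phi (b j).
(* [V] is the S-span of the [e j] plus the ideal of the [h i]; it has to be all of S[y]. *)
pose V p := exists (c : 'I_D -> S) (q : 'I_m -> {mpoly S[n]}),
  p = \sum_j c j *: e j + \sum_i h i * q i.
have VD p q : V p -> V q -> V (p + q).
  move=> [c [u ->]] [d [v ->]].
  exists (fun j => c j + d j), (fun i => u i + v i).
  rewrite addrACA -!big_split; congr (_ + _); apply: eq_bigr => i _.
    by rewrite scalerDl.
  by rewrite mulrDr.
have VZ a p : V p -> V (a *: p).
  move=> [c [u ->]]; exists (fun j => a * c j), (fun i => a *: u i).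
  rewrite scalerDr !scaler_sumr; congr (_ + _); apply: eq_bigr => i _.
    by rewrite scalerA.
  by rewrite -scalerAr.
have V0 : V 0.
  exists (fun=> 0), (fun=> 0).
  by rewrite !big1 ?addr0 // => i _; rewrite ?scale0r ?mulr0.
have V_sum (J : eqType) (r : seq J) (f : J -> {mpoly S[n]}) :
  (forall i, V (f i)) -> V (\sum_(i <- r) f i) by move=> Vf; apply: big_ind.
have Vphi p : V (phi p).
  have [c /ideal_ofP[v /eqP]] := F_zd p; rewrite subr_eq addrC => /eqP->.
  exists (fun j => pi (c j)%:MP), (fun i => phi (v i)).
  rewrite rmorphD !rmorph_sum; congr (_ + _); apply: eq_bigr => i _.
    exact: phiZ.
  by rewrite rmorphM mulrC.
have Vh i q : V (h i * q).
  exists (fun=> 0), (fun l => if l == i then q else 0).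
  rewrite big1 => [|j _]; last by rewrite scale0r.
  rewrite add0r (bigD1 i) //= eqxx big1 ?addr0 // => l /negPf->.
  by rewrite mulr0.
(* Since y_i = [phi 'X_i] - a_i, the product y_i e_j is [phi ('X_i * b j)] - a_i e_j, and [V]
   contains the image of [phi]. *)
have VX i p : V p -> V ('X_i * p).
  move=> [c [q ->]]; rewrite mulrDr !mulr_sumr; apply: (VD); apply: V_sum => j.
    rewrite -scalerAr; apply: (VZ).
    have -> : 'X_i * e j = phi ('X_i * b j) + (- pi 'X_i) *: e j.
      by rewrite rmorphM phiX mulrDl mul_mpolyC scaleNr addrAC subrr add0r.
    by apply: (VD) => //; apply/VZ/Vphi.
  by rewrite mulrCA.
(* Starting from 1 = [phi 1], multiplication by variables reaches every monomial. *)
move=> p; rewrite (mpolyE p); apply: V_sum => m'; apply: (VZ).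
rewrite mpolyXE_id; elim: (index_enum _) => [|i r IHr].
  by rewrite big_nil -(rmorph1 phi).
rewrite big_cons; elim: (m' i) => [|d IHd]; first by rewrite mul1r.
by rewrite exprS -mulrA; apply: VX.
Qed.

End Generators.

(** * A Gröbner basis generates its ideal *)

Section Groebner.
Variables (k : fieldType) (n : nat) (le : rel 'X_{1..n}).
Hypothesis le_term : term_order le.

Lemma is_LT_exists (f : {mpoly k[n]}) : f != 0 -> exists m, is_LT le f m.
Proof.
have [[le_refl _ le_trans le_total] _] := le_term.
rewrite -msupp_eq0 /is_LT; elim: (msupp f : seq _) => //= m s IHs _.
have [->|/IHs[m' [m's m'max]]] := eqVneq s [::].
  by exists m; rewrite mem_head; split=> // m'; rewrite inE => /eqP->.
have [le_m|le_m'] := orP (le_total m m').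
  exists m'; rewrite inE m's orbT; split=> // l.
  by rewrite inE => /predU1P[->//|/m'max].
exists m; rewrite mem_head; split=> // l; rewrite inE => /predU1P[->//|/m'max].
by move/le_trans; apply.
Qed.

(** Division by [G]: a multiple of an entry cancels the leading term of [p], and the remainder,
    still in [I], is handled by well-founded induction. *)
Lemma groebner_basis_generates (I : {mpoly k[n]} -> Prop) t
    (G : 'cV[{mpoly k[n]}]_t) :
  is_ideal I -> groebner_basis le I G -> same_set (ideal_of G) I.
Proof.
move=> [I0 ID IM] [GI LTE] p; split.
  move=> [r [a [g [Gg ->]]]]; apply: big_ind => // i _.
  by apply: IM; apply: GI.
have [J0 JD JM] := ideal_of_ideal G.
have [[le_refl le_anti le_trans le_total] [le0 leD]] := le_term.
have [->//|/is_LT_exists[m]] := eqVneq p 0.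
elim/(well_founded_ind (term_order_wf le_term)): m p => m IHm p [mp m_max] Ip.
have /LTE[r [a [g [LTg XE]]]] : ideal_span (LT_set le I) 'X_[m].
  exists 1%N, (fun=> 1), (fun=> 'X_[m]); rewrite big_ord1 mul1r; split=> // _.
  by exists p, m.
(* The summands' coefficients at [m] add up to 1, so one is nonzero; as [g i] is a leading monomial,
   it divides [m]. *)
have [i /eqP ai_neq0] : exists i, (a i * g i)@_m <> 0.
  apply: NNPP => nex; have /eqP := congr1 (mcoeff m) XE.
  rewrite mcoeffX eqxx raddf_sum big1 ?oner_eq0 // => i _.
  by apply: NNPP => ai_neq0; apply: nex; exists i.
have [q [m1 [Gq [m1q m1_max] gE]]] := LTg i.
have [m2 mE] : exists m2, m = (m1 + m2)%MM.
  move: ai_neq0; rewrite gE -mcoeff_msupp (perm_mem (msuppMX _ _)).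
  by case/mapP => m2 _ ->; exists m2.
pose c := p@_m / q@_m1; pose p' := p - c *: ('X_[m2] * q).
have Jq : ideal_of G ('X_[m2] * q).
  by apply: JM; exists 1%N, (fun=> 1), (fun=> q); rewrite big_ord1 mul1r.
have JZ d f : ideal_of G f -> ideal_of G (d *: f).
  by rewrite -mul_mpolyC; apply: JM.
have -> : p = p' + c *: ('X_[m2] * q) by rewrite subrK.
apply: (JD); last exact: JZ.
have Ip' : I p'.
  rewrite /p' -scaleNr -mul_mpolyC; apply: ID => //.
  by apply/IM/IM/GI.
have [->//|/is_LT_exists[m' [m'p' m'_max]]] := eqVneq p' 0.
(* The choice of [c] cancels [m]; all other monomials of [p'] come from [p] or ['X_[m2] * q], both
   bounded by [m]. *)
apply: (IHm m') => //; apply/andP; split.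
  apply: contraTneq m'p' => ->; rewrite mcoeff_msupp negbK mcoeffB mcoeffZ.
  rewrite (mulrC 'X_[m2]) {2}mE addmC mcoeffMX divfK ?subrr //.
  by rewrite -mcoeff_msupp.
have: m' \in msupp p ++ msupp ('X_[m2] * q).
  apply: contraTT m'p'; rewrite mem_cat negb_or !mcoeff_msupp !negbK.
  by move=> /andP[/eqP p0 /eqP q0]; rewrite mcoeffB mcoeffZ p0 q0 mulr0 subrr.
rewrite mem_cat => /orP[/m_max//|]; rewrite mulrC (perm_mem (msuppMX _ _)).
by case/mapP => l /m1_max le_l ->; rewrite mE addmC; apply: leD.
Qed.

End Groebner.

(** * The three assertions about F = AG *)

Theorem theorem4p6 (k : fieldType) (n s t : nat) (hn : (1 <= n)%N)
    (le : rel 'X_{1..n}) (hle : term_order le)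
    (I : {mpoly k[n]} -> Prop) (hI : is_proper_ideal I)
    (hI0 : zero_dimensional I)
    (G : 'cV[{mpoly k[n]}]_t) (hG : groebner_basis le I G)
    (A : 'M[{mpoly k[n]}]_(s, t))
    (F : 'cV[{mpoly k[n]}]_s) (hF : F = A *m G) :
  (same_set (ideal_of F) (ideal_of G) -> (n <= s)%N)
  /\ ((exists B : 'M[{mpoly k[n]}]_(t, s), B *m A = 1%:M) ->
      same_set (ideal_of F) (ideal_of G))
  /\ (same_set (ideal_of F) (ideal_of G) <->
      exists B : 'M[{mpoly k[n]}]_(t, s),
        forall i : 'I_t, syzygy G (row i (B *m A - 1%:M))).
Proof.
(* Pairing row i of BA - E_t with G gives entry i of BF - G. *)
have syzygyE (B : 'M_(t, s)) :
    (forall i, syzygy G (row i (B *m A - 1%:M))) <-> B *m F = G.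
  have syzE i : \sum_j (row i (B *m A - 1%:M)) 0 j * G j 0 = (B *m F - G) i 0.
    rewrite hF mulmxA -[X in _ *m G - X]mul1mx -mulmxBl [RHS]mxE.
    by apply: eq_bigr => j _; rewrite mxE.
  split=> [syz|BF i]; last by rewrite /syzygy syzE BF subrr mxE.
  by apply/subr0_eq/matrixP => i j; rewrite (ord1 j) -syzE syz mxE.
have FG p : ideal_of F p -> ideal_of G p.
  by rewrite hF; apply: ideal_of_mulmx.
(* The third assertion comes first: a left inverse satisfies BF = G, so the second follows from
   it. *)
have part3 : same_set (ideal_of F) (ideal_of G) <->
    exists B : 'M[{mpoly k[n]}]_(t, s),
      forall i : 'I_t, syzygy G (row i (B *m A - 1%:M)).
  split=> [FGE|[B /syzygyE BF] p]; last first.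
    by split=> [/FG//|]; rewrite -BF; apply: ideal_of_mulmx.
  have /fin_all_exists[v vE] (i : 'I_t) :
      exists v : 'I_s -> {mpoly k[n]}, G i 0 = \sum_j v j * F j 0.
    by apply/ideal_ofP/FGE/entry_ideal_of.
  exists (\matrix_(i, j) v i j); apply/syzygyE/matrixP => i j.
  by rewrite (ord1 j) vE mxE; apply: eq_bigr => l _; rewrite mxE.
split; last split=> //.
  (* Now both vectors generate [I], so the ideal of [F] inherits properness and
     zero-dimensionality. *)
  move=> FGE; have GI := groebner_basis_generates hle hI.1 hG.
  have FI p : ideal_of F p <-> I p by rewrite FGE.
  apply: (@zero_dimensional_generators k n s F).
    split; first exact: ideal_of_ideal.
    by have [_ [p nIp]] := hI; exists p => /FI.
  have [d [b bI]] := hI0; exists d, b => p.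
  by have [c Ic] := bI p; exists c; apply/FI.
move=> [B BA]; apply/part3; exists B; apply/syzygyE.
by rewrite hF mulmxA BA mul1mx.
Qed.
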